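(* Let $s$ be a complex number with $\Re(s) > 1$, and let $m$ and $n$ be (fixed) nonnegative integers. Then Riemann's zeta function satisfies both of the following limit formulas, where $q$ runs through the positive integers if $n \geq 1$, and through the integers $q \geq 2$ if $n = 0$: (a) $$\zeta(s) = \lim_{q \to \infty} \left(\frac{\pi}{2q+m}\right)^{s} \sum_{p=1}^{\lfloor (2q+n-1)/2 \rfloor} \cot^{s}\left(\frac{p\,\pi}{2q+n}\right);$$ (b) $$\zeta(s) = \lim_{q \to \infty} \left(\frac{\pi}{2q+m}\right)^{s} \sum_{p=1}^{\lfloor (2q+n-1)/2 \rfloor} \csc^{s}\left(\frac{p\,\pi}{2q+n}\right).$$
   Context: $\zeta(s)$ denotes Riemann's zeta function, given for $\Re(s)>1$ by $\zeta(s)=\sum_{k=1}^{\infty} k^{-s}$. $\lfloor x \rfloor$ is the largest integer less than or equal to the real number $x$. The notation $\cot^{s}(x)$ means $(\cot x)^{s}$ and $\csc^{s}(x)$ means $(\csc x)^{s}$, where $\csc x = 1/\sin x$. In the sums the index $p$ runs over positive integers, and every argument $p\pi/(2q+n)$ lies in $(0,\pi/2)$, so all bases of complex powers are positive real numbers; for a real $t>0$ and complex $s$, $t^{s}=\exp(s\log t)$ with $\log$ the real natural logarithm. *)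

(* Defs.v *)
From Stdlib Require Import Reals.
From Coquelicot Require Import Coquelicot.
Open Scope R_scope.

Definition Cexp (z : C) : C :=
  (exp (Re z) * cos (Im z), exp (Re z) * sin (Im z)).

(* Meant for t > 0 only: [ln] takes a junk value elsewhere. *)
Definition Rcpow (t : R) (s : C) : C := Cexp (s * RtoC (ln t))%C.

Definition cot (x : R) : R := cos x / sin x.

Definition csc (x : R) : R := 1 / sin x.

(* The term of index k is (k+1)^(-s), as the Dirichlet series starts at 1. *)
Definition zeta_term (s : C) (k : nat) : C := Rcpow (INR (S k)) (Copp s).

(* Coquelicot has no total sum operator for series in C, so the sum is taken
   on real and imaginary parts.  Meant for Re s > 1 only. *)
Definition zeta (s : C) : C :=
  (Series (fun k => Re (zeta_term s k)), Series (fun k => Im (zeta_term s k))).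

Lemma is_series_Re_Im (a : nat -> C) (z : C) :
  is_series a z ->
  is_series (fun k => Re (a k)) (Re z) /\ is_series (fun k => Im (a k)) (Im z).
Proof.
intros H.
assert (E : forall n, sum_n a n = (sum_n (fun k => Re (a k)) n,
                                   sum_n (fun k => Im (a k)) n)).
{ induction n as [|n IH].
  - rewrite !sum_O; now destruct (a O).
  - rewrite !sum_Sn, IH; now destruct (a (S n)). }
split; intros P [e He]; destruct (H (fun w => ball z e w)) as [N HN];
  try (now exists e); exists N; intros n Hn; apply He;
  specialize (HN n Hn); rewrite E in HN; apply HN.
Qed.

Lemma zeta_unique (s z : C) : is_series (zeta_term s) z -> zeta s = z.
Proof.
intros H; apply is_series_Re_Im in H; destruct H as [HR HI].
unfold zeta; rewrite (is_series_unique _ _ HR), (is_series_unique _ _ HI).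
now destruct z.
Qed.

(* Main.v *)
Require Import Defs.
From Stdlib Require Import Reals Lra Lia.
From Coquelicot Require Import Coquelicot.
Open Scope R_scope.

(* Let f be cot or csc.  Absorbing the prefactor, the p-th summand becomes
   t^s with t = PI/(2q+m) f(p PI/(2q+n)).  Since x f(x) -> 1 as x -> 0+, t tends
   to 1/p for fixed p, and f(x) <= 3/x on (0, PI/2) gives t <= 3(n+1)/p, so the
   summands are dominated by a constant times p^(-Re s).  Tannery's theorem,
   applied to real and imaginary parts, then allows the limit to be taken term
   by term. *)

(** * Sums and series of real numbers *)

Lemma sum_n_m_le_loc (a b : nat -> R) (n m : nat) :
  (forall k, (n <= k <= m)%nat -> a k <= b k) ->
  sum_n_m a n m <= sum_n_m b n m.
Proof.
intros H.
(* Replacing [a] by its minimum with [b] makes the inequality hold at every index and leaves the sum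
   over the range unchanged. *)
rewrite (sum_n_m_ext_loc a (fun k => Rmin (a k) (b k))).
- apply sum_n_m_le; intros k; apply Rmin_r.
- intros k Hk; symmetry; apply Rmin_left, H, Hk.
Qed.

Lemma sum_n_minus (a b : nat -> R) (n : nat) :
  sum_n (fun k => a k - b k) n = sum_n a n - sum_n b n.
Proof.
induction n as [|n IH].
- now rewrite !sum_O.
- rewrite !sum_Sn, IH; unfold plus; simpl; ring.
Qed.

Lemma is_lim_seq_sum_n (a : nat -> nat -> R) (b : nat -> R) (K : nat) :
  (forall k, is_lim_seq (fun q => a q k) (b k)) ->
  is_lim_seq (fun q => sum_n (a q) K) (sum_n b K).
Proof.
intros H; induction K as [|K IH].
- rewrite sum_O; eapply is_lim_seq_ext; [|apply (H O)].
  intros q; now rewrite sum_O.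
- rewrite sum_Sn; eapply is_lim_seq_ext.
  + intros q; symmetry; apply sum_Sn.
  + apply is_lim_seq_plus'; [exact IH|apply H].
Qed.

(** A fixed head converges term by term, and the remaining tails are controlled uniformly in [q] by
    those of [M]. Domination is asked only for [k <= L q], because outside the summation range the
    trigonometric arguments may leave (0, PI/2). *)
Lemma tannery (a : nat -> nat -> R) (b M : nat -> R) (L : nat -> nat) :
  filterlim L eventually eventually ->
  (forall k, is_lim_seq (fun q => a q k) (b k)) ->
  ex_series M ->
  eventually (fun q => forall k, (k <= L q)%nat -> Rabs (a q k) <= M k) ->
  is_lim_seq (fun q => sum_n (a q) (L q)) (Series b).
Proof.
intros HL Hab HM Hdom.
(* The bound passes to the limit: a fixed [k] lies in the range [k <= L q] for all large [q]. *)
assert (HbM : forall k, Rabs (b k) <= M k).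
{ intros k.
  apply (is_lim_seq_le_loc (fun q => Rabs (a q k)) (fun _ => M k)
           (Finite (Rabs (b k))) (Finite (M k))).
  - assert (Hk : eventually (fun q => (k <= L q)%nat)).
    { apply (HL (fun l => (k <= l)%nat)); exists k; auto. }
    generalize (filter_and _ _ Hdom Hk); apply filter_imp.
    intros q [H1 H2]; auto.
  - apply (is_lim_seq_abs _ (Finite (b k))), Hab.
  - apply is_lim_seq_const. }
assert (Hb : ex_series b).
{ apply (ex_series_le (K := R_AbsRing) (V := R_CompleteNormedModule) b M); auto. }
assert (Hdiff : is_lim_seq (fun q => sum_n (a q) (L q) - sum_n b (L q)) 0).
{ apply is_lim_seq_spec; intros eps; simpl.
  assert (He3 : 0 < eps / 3) by (generalize (cond_pos eps); lra).
  (* The sum is cut at [N]: the head is below [eps / 3] for large [q], and the tail is at most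
     [2 * (eps / 3)] because there |a - b| <= 2 M. *)
  destruct (Cauchy_ex_series M HM (mkposreal _ He3)) as [N HN]; simpl in HN.
  assert (HS : is_lim_seq (fun q => sum_n (fun k => Rabs (a q k - b k)) N) 0).
  { rewrite <- (Rmult_0_r (INR (S N))), <- sum_n_const.
    apply (is_lim_seq_sum_n (fun q k => Rabs (a q k - b k)) (fun _ => 0)).
    intros k; replace 0 with (Rabs (b k - b k))
      by (rewrite Rminus_diag; apply Rabs_R0).
    apply (is_lim_seq_abs _ (Finite (b k - b k))), is_lim_seq_minus'.
    - apply Hab.
    - apply is_lim_seq_const. }
  apply is_lim_seq_spec in HS; specialize (HS (mkposreal _ He3)); simpl in HS.
  assert (HLN : eventually (fun q => (N <= L q)%nat)).
  { apply (HL (fun l => (N <= l)%nat)); exists N; auto. }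
  generalize (filter_and _ _ Hdom (filter_and _ _ HS HLN)).
  apply filter_imp; intros q [H1 [H2 H3]].
  rewrite Rminus_0_r in H2 |- *; rewrite <- sum_n_minus.
  apply Rle_lt_trans with (sum_n (fun k => Rabs (a q k - b k)) (L q)).
  { apply (norm_sum_n_m (K := R_AbsRing) (V := R_NormedModule)). }
  unfold sum_n in *.
  rewrite (sum_n_m_Chasles _ 0 N (L q)) by lia.
  assert (H4 : sum_n_m (fun k => Rabs (a q k - b k)) (S N) (L q)
               <= sum_n_m (fun k => 2 * M k) (S N) (L q)).
  { apply sum_n_m_le_loc; intros k Hk.
    generalize (Rabs_triang (a q k) (- b k)), (H1 k (proj2 Hk)), (HbM k).
    rewrite Rabs_Ropp; unfold Rminus; lra. }
  rewrite (sum_n_m_mult_l (K := R_Ring) 2 M) in H4.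
  assert (H5 : sum_n_m M (S N) (L q) < eps / 3).
  { destruct (Nat.eq_dec N (L q)) as [E|E].
    - rewrite sum_n_m_zero by lia; exact He3.
    - eapply Rle_lt_trans; [apply Rle_abs|apply HN; lia]. }
  replace (pos eps) with (eps / 3 + 2 * (eps / 3)) by field.
  apply Rplus_lt_le_compat; [eapply Rle_lt_trans; [apply Rle_abs|exact H2]|].
  eapply Rle_trans; [exact H4|].
  apply Rmult_le_compat_l; [lra|now apply Rlt_le]. }
apply is_lim_seq_ext
  with (fun q => (sum_n (a q) (L q) - sum_n b (L q)) + sum_n b (L q)).
{ intros q; ring. }
replace (Finite (Series b)) with (Finite (0 + Series b)) by (f_equal; ring).
apply is_lim_seq_plus'; [exact Hdiff|].
unfold is_lim_seq.
apply (filterlim_comp _ _ _ L (sum_n b) _ eventually _ HL).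
apply (Series_correct b Hb).
Qed.

(* With [g k = k^(1-r)], the inequality [1 + t <= exp t] yields
   [(r-1) (k+1)^(-r) <= g k - g (k+1)], and the right-hand side telescopes. *)
Lemma ex_series_Rpower (r : R) :
  1 < r -> ex_series (fun k => exp (- r * ln (INR (S k)))).
Proof.
intros Hr.
set (g := fun k : nat => exp ((1 - r) * ln (INR (S k)))).
assert (Hpos : forall k, 0 < INR (S k)) by (intros k; apply lt_0_INR; lia).
assert (Hstep : forall k,
  (r - 1) * exp (- r * ln (INR (S (S k)))) <= g k - g (S k)).
{ intros k; unfold g.
  set (x := INR (S k)); set (y := INR (S (S k))).
  assert (Hx : 0 < x) by apply Hpos; assert (Hy : 0 < y) by apply Hpos.
  assert (Hxy : y = x + 1) by (unfold x, y; now rewrite (S_INR (S k))).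
  replace (exp ((1 - r) * ln x))
    with (exp ((1 - r) * ln y) * exp ((r - 1) * (ln y - ln x)))
    by (rewrite <- exp_plus; f_equal; ring).
  replace (exp (- r * ln y)) with (exp ((1 - r) * ln y) * / y).
  2:{ rewrite <- (exp_ln y Hy) at 2; rewrite <- exp_Ropp, <- exp_plus.
      f_equal; ring. }
  (* This is 1 + u <= exp u at u = ln x - ln y, where exp u = x / y = 1 - 1 / y. *)
  assert (H1 : / y <= ln y - ln x).
  { generalize (exp_ineq1_le (ln x - ln y)).
    replace (exp (ln x - ln y)) with (1 - / y); [lra|].
    unfold Rminus at 2; rewrite exp_plus, exp_Ropp, !exp_ln by assumption.
    rewrite Hxy; field; lra. }
  generalize (exp_ineq1_le ((r - 1) * (ln y - ln x))); intros H2.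
  assert (H3 : (r - 1) * / y <= (r - 1) * (ln y - ln x))
    by (apply Rmult_le_compat_l; lra).
  generalize (exp_pos ((1 - r) * ln y)); nra. }
apply ex_series_incr_1.
apply (ex_finite_lim_seq_incr _ (g O / (r - 1))).
- intros n; rewrite sum_Sn.
  rewrite <- (Rplus_0_r (sum_n _ n)) at 1.
  apply Rplus_le_compat_l, Rlt_le, exp_pos.
- intros n; apply Rmult_le_reg_l with (r - 1); [lra|].
  replace ((r - 1) * (g O / (r - 1))) with (g O) by (field; lra).
  (* Keeping the term [- g (S n)] of the telescoped sum is what lets the induction go through. *)
  enough (H : (r - 1) * sum_n (fun k => exp (- r * ln (INR (S (S k))))) n
              <= g O - g (S n))
    by (assert (Hg : 0 < g (S n)) by apply exp_pos;
        eapply Rle_trans; [exact H|lra]).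
  induction n as [|n IH].
  + rewrite sum_O; apply Hstep.
  + rewrite sum_Sn.
    eapply Rle_trans; [apply Req_le, Rmult_plus_distr_l|].
    replace (g O - g (S (S n))) with (g O - g (S n) + (g (S n) - g (S (S n))))
      by ring.
    apply Rplus_le_compat; [exact IH|apply Hstep].
Qed.

(** * Complex powers of positive reals *)

Lemma Re_Rcpow (t : R) (s : C) :
  Re (Rcpow t s) = exp (Re s * ln t) * cos (Im s * ln t).
Proof.
unfold Rcpow, Cexp, Re, Im; simpl; f_equal; f_equal; ring.
Qed.

Lemma Im_Rcpow (t : R) (s : C) :
  Im (Rcpow t s) = exp (Re s * ln t) * sin (Im s * ln t).
Proof.
unfold Rcpow, Cexp, Re, Im; simpl; f_equal; f_equal; ring.
Qed.

Lemma Rcpow_mult (t u : R) (s : C) :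
  0 < t -> 0 < u -> (Rcpow t s * Rcpow u s)%C = Rcpow (t * u) s.
Proof.
intros Ht Hu.
assert (Hln : ln (t * u) = ln t + ln u) by now apply ln_mult.
(* Stated for arbitrary [z] and [w], so that the product is expanded without unfolding [Rcpow]. *)
assert (E : forall z w : C,
  Re (z * w)%C = Re z * Re w - Im z * Im w /\ Im (z * w)%C = Re z * Im w + Im z * Re w)
  by now intros.
destruct (E (Rcpow t s) (Rcpow u s)) as [ER EI].
apply injective_projections; fold (Re (Rcpow t s * Rcpow u s)%C)
  (Im (Rcpow t s * Rcpow u s)%C) (Re (Rcpow (t * u) s)) (Im (Rcpow (t * u) s));
  rewrite ?ER, ?EI, !Re_Rcpow, !Im_Rcpow, Hln, !Rmult_plus_distr_l,
    exp_plus, ?cos_plus, ?sin_plus; ring.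
Qed.

Lemma Rcpow_inv (t : R) (s : C) : 0 < t -> Rcpow (/ t) s = Rcpow t (- s)%C.
Proof.
intros Ht; unfold Rcpow; rewrite ln_Rinv by assumption; f_equal.
apply injective_projections; simpl; ring.
Qed.

(** The modulus of t^s is t^(Re s), which is nondecreasing in t when Re s >= 0 and dominates both
    coordinates. *)
Lemma Rcpow_bound (t u : R) (s : C) :
  0 <= Re s -> 0 < t -> t <= u ->
  Rabs (Re (Rcpow t s)) <= exp (Re s * ln u) /\
  Rabs (Im (Rcpow t s)) <= exp (Re s * ln u).
Proof.
intros Hs Ht Htu; rewrite Re_Rcpow, Im_Rcpow, !Rabs_mult.
assert (H : exp (Re s * ln t) <= exp (Re s * ln u)).
{ apply Rnot_lt_le; intros H; apply exp_lt_inv in H; revert H.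
  apply Rle_not_lt, Rmult_le_compat_l; [assumption|now apply ln_le]. }
rewrite (Rabs_pos_eq _ (Rlt_le _ _ (exp_pos (Re s * ln t)))).
generalize (exp_pos (Re s * ln t)); intros H0.
assert (Hc : Rabs (cos (Im s * ln t)) <= 1)
  by (apply Rabs_le; generalize (COS_bound (Im s * ln t)); lra).
assert (Hs' : Rabs (sin (Im s * ln t)) <= 1)
  by (apply Rabs_le; generalize (SIN_bound (Im s * ln t)); lra).
split; nra.
Qed.

Lemma is_lim_seq_Rcpow (u : nat -> R) (l : R) (s : C) :
  0 < l -> is_lim_seq u l ->
  is_lim_seq (fun q => Re (Rcpow (u q) s)) (Re (Rcpow l s)) /\
  is_lim_seq (fun q => Im (Rcpow (u q) s)) (Im (Rcpow l s)).
Proof.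
intros Hl Hu.
assert (Hln : forall c, is_lim_seq (fun q => c * ln (u q)) (c * ln l)).
{ intros c; apply (is_lim_seq_scal_l _ c (Finite (ln l))).
  apply is_lim_seq_continuous; [|exact Hu].
  apply derivable_continuous_pt; exists (/ l); now apply derivable_pt_lim_ln. }
assert (Hexp : is_lim_seq (fun q => exp (Re s * ln (u q))) (exp (Re s * ln l)))
  by (apply (is_lim_seq_continuous exp); [apply derivable_continuous_pt, derivable_pt_exp|apply Hln]).
rewrite Re_Rcpow, Im_Rcpow; split.
- eapply is_lim_seq_ext; [intros q; symmetry; apply Re_Rcpow|].
  apply is_lim_seq_mult'; [exact Hexp|].
  apply is_lim_seq_continuous; [apply continuity_cos|apply Hln].
- eapply is_lim_seq_ext; [intros q; symmetry; apply Im_Rcpow|].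
  apply is_lim_seq_mult'; [exact Hexp|].
  apply is_lim_seq_continuous; [apply continuity_sin|apply Hln].
Qed.

Lemma Re_Im_sum_n (a : nat -> C) (n : nat) :
  sum_n a n = (sum_n (fun k => Re (a k)) n, sum_n (fun k => Im (a k)) n).
Proof.
induction n as [|n IH].
- rewrite !sum_O; now destruct (a O).
- rewrite !sum_Sn, IH; now destruct (a (S n)).
Qed.

(** Balls of [C] are products of real balls, so convergence may be checked on each coordinate. *)
Lemma filterlim_C {T : Type} (F : (T -> Prop) -> Prop) {FF : Filter F}
    (f : T -> C) (z : C) :
  filterlim (fun x => Re (f x)) F (locally (Re z)) ->
  filterlim (fun x => Im (f x)) F (locally (Im z)) ->
  filterlim f F (locally z).
Proof.
intros HR HI P [eps HP]; unfold filtermap.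
apply (filter_imp (fun x => ball (Re z) eps (Re (f x)) /\ ball (Im z) eps (Im (f x)))).
- intros x [H1 H2]; apply HP; now split.
- apply filter_and; [apply (HR (ball (Re z) eps))|apply (HI (ball (Im z) eps))];
    apply locally_ball.
Qed.

(** * Trigonometric bounds and limits *)

(** The Taylor polynomial of degree 7 bounds sin from below. As x < 2, x - x^3/6 >= x - 4x/6 = x/3,
    and x^5/120 - x^7/5040 is nonnegative. *)
Lemma sin_ge_third (x : R) : 0 < x < PI / 2 -> x / 3 <= sin x.
Proof.
intros [H0 H1]; generalize PI_4; intros H4.
destruct (SIN x) as [H _]; [lra|lra|].
revert H; unfold sin_lb, sin_approx, sin_term; simpl; intros H.
assert (Hx2 : 0 < x * x <= 4) by (split; nra).
assert (H5 : 0 < x * x * x <= 4 * x) by (split; nra).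
assert (H6 : 0 < x * x * x * (x * x)) by nra.
assert (H7 : x * x * x * (x * x) * (x * x) <= 4 * (x * x * x * (x * x))) by nra.
nra.
Qed.

Lemma csc_bounds (x : R) : 0 < x < PI / 2 -> 0 < csc x <= 3 / x.
Proof.
intros Hx; generalize (sin_ge_third x Hx); intros Hs; unfold csc; split.
- apply Rdiv_lt_0_compat; lra.
- replace (3 / x) with (1 / (x / 3)) by (field; lra).
  apply Rmult_le_compat_l; [lra|apply Rinv_le_contravar; lra].
Qed.

Lemma cot_bounds (x : R) : 0 < x < PI / 2 -> 0 < cot x <= 3 / x.
Proof.
intros Hx; destruct (csc_bounds x Hx) as [H1 H2].
assert (Hc : 0 < cos x) by (apply cos_gt_0; lra).
replace (cot x) with (cos x * csc x) by (unfold cot, csc, Rdiv; ring).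
generalize (COS_bound x); intros [_ Hc1]; split; nra.
Qed.

Lemma is_lim_mult_csc : is_lim (fun x => x * csc x) 0 1.
Proof.
(* The identity holds at every x, zeros of sin included, since [Rinv_mult] and [Rinv_inv] are valid
   at 0 too. *)
apply is_lim_ext with (fun x => / (sin x / x)).
- intros x; unfold csc, Rdiv; rewrite Rinv_mult, Rinv_inv; ring.
- replace (Finite 1) with (Rbar_inv 1) by (simpl; f_equal; field).
  apply is_lim_inv; [apply is_lim_sinc_0|].
  intros H; injection H; lra.
Qed.

Lemma is_lim_mult_cot : is_lim (fun x => x * cot x) 0 1.
Proof.
apply is_lim_ext with (fun x => cos x * (x * csc x)).
- intros x; unfold cot, csc, Rdiv; ring.
- replace (Finite 1) with (Rbar_mult (Finite 1) (Finite 1))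
    by (simpl; f_equal; ring).
  apply is_lim_mult; [|apply is_lim_mult_csc|exact I].
  rewrite <- cos_0; apply is_lim_continuity, continuity_cos.
Qed.

(** * The limit formula *)

Lemma filterlim_eventually_of_le (L : nat -> nat) (c : nat) :
  (forall q, (q <= L q + c)%nat) -> filterlim L eventually eventually.
Proof.
intros HL P [N HN]; exists (N + c)%nat; intros q Hq; apply HN.
specialize (HL q); lia.
Qed.

Lemma is_lim_seq_div_affine (c : R) (m : nat) :
  is_lim_seq (fun q => c / INR (2 * q + m)) 0.
Proof.
replace (Finite 0) with (Rbar_mult c (Rbar_inv p_infty))
  by (simpl; f_equal; ring).
apply is_lim_seq_scal_l, is_lim_seq_inv; [|discriminate].
apply (filterlim_comp _ _ _ (fun q => (2 * q + m)%nat) INR _ eventually).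
- apply (filterlim_eventually_of_le _ 0); intros q; lia.
- apply is_lim_seq_INR.
Qed.

(** The bound on [f] provides the domination and its behaviour at 0 the termwise limits; cot and csc
    enter only through these two properties. *)
Lemma zeta_limit (f : R -> R) (s : C) (m n : nat) :
  (forall x, 0 < x < PI / 2 -> 0 < f x <= 3 / x) ->
  is_lim (fun x => x * f x) 0 1 ->
  1 < Re s ->
  filterlim
    (fun q : nat =>
       (Rcpow (PI / INR (2 * q + m)) s *
        sum_n_m (fun p : nat => Rcpow (f (INR p * PI / INR (2 * q + n))%R) s)
          1 ((2 * q + n - 1) / 2))%C)
    eventually (locally (zeta s)).
Proof.
intros Hf Hlim hs.
(* With p = k + 1 the sum starts at 0 and ends at [L q]. For q >= 2 the original upper index is at
   least 1, so [pred] does not truncate. *)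
set (L := fun q : nat => pred ((2 * q + n - 1) / 2)).
set (t := fun q k : nat =>
  PI / INR (2 * q + m) * f (INR (S k) * PI / INR (2 * q + n))).
assert (Hpos : forall k, 0 < INR (S k)) by (intros k; apply lt_0_INR; lia).
assert (Hx : forall q k, (2 <= q)%nat -> (k <= L q)%nat ->
  0 < INR (S k) * PI / INR (2 * q + n) < PI / 2).
{ intros q k Hq Hk; generalize PI_RGT_0, (Hpos k); intros Hpi Hk0.
  assert (HN : 0 < INR (2 * q + n)) by (apply lt_0_INR; lia).
  (* Since p is at most the floor of (2q+n-1)/2, 2p <= 2q+n-1 < 2q+n, which puts the argument below
     PI/2. *)
  assert (H2k : INR 2 * INR (S k) < INR (2 * q + n)).
  { rewrite <- mult_INR; apply lt_INR; unfold L in Hk.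
    generalize (Nat.Div0.mul_div_le (2 * q + n - 1) 2).
    assert (1 <= (2 * q + n - 1) / 2)%nat by (apply Nat.div_le_lower_bound; lia).
    lia. }
  simpl INR in H2k at 1.
  split; [apply Rdiv_lt_0_compat; nra|].
  apply Rmult_lt_reg_r with (INR (2 * q + n)); [assumption|].
  replace (INR (S k) * PI / INR (2 * q + n) * INR (2 * q + n))
    with (INR (S k) * PI) by (field; lra).
  nra. }
assert (Ht : forall q k, (2 <= q)%nat -> (k <= L q)%nat ->
  0 < t q k <= 3 * INR (S n) * / INR (S k)).
{ intros q k Hq Hk; generalize PI_RGT_0, (Hpos k); intros Hpi Hk0.
  destruct (Hf _ (Hx q k Hq Hk)) as [Hf0 Hf1]; unfold t.
  assert (HN : 0 < INR (2 * q + n)) by (apply lt_0_INR; lia).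
  assert (Hm : 0 < INR (2 * q + m)) by (apply lt_0_INR; lia).
  assert (Hpm : 0 < PI / INR (2 * q + m)) by now apply Rdiv_lt_0_compat.
  split; [now apply Rmult_lt_0_compat|].
  eapply Rle_trans; [apply Rmult_le_compat_l; [lra|exact Hf1]|].
  replace (PI / INR (2 * q + m) * (3 / (INR (S k) * PI / INR (2 * q + n))))
    with (3 * (INR (2 * q + n) / INR (2 * q + m)) * / INR (S k))
    by (field; repeat split; lra).
  apply Rmult_le_compat_r; [now apply Rlt_le, Rinv_0_lt_compat|].
  apply Rmult_le_compat_l; [lra|].
  (* The ratio (2q+n)/(2q+m) is at most n+1, because 2q+n <= (n+1)(2q+m) once q >= 1. *)
  apply Rmult_le_reg_r with (INR (2 * q + m)); [assumption|].
  unfold Rdiv; rewrite Rmult_assoc, Rinv_l, Rmult_1_r, <- mult_INR by lra.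
  apply le_INR; nia. }
assert (Htlim : forall k, is_lim_seq (fun q => t q k) (/ INR (S k))).
{ intros k.
  set (x := fun q : nat => INR (S k) * PI / INR (2 * q + n)).
  (* [is_lim] is a limit over a punctured neighbourhood, so the sequence must eventually avoid 0. *)
  assert (Hx0 : eventually (fun q => Finite (x q) <> Finite 0)).
  { exists 1%nat; intros q Hq H; injection H; unfold x.
    apply Rgt_not_eq, Rdiv_lt_0_compat;
      [apply Rmult_lt_0_compat; [apply Hpos|apply PI_RGT_0]|apply lt_0_INR; lia]. }
  generalize (is_lim_comp_seq _ x _ _ Hlim Hx0
                (is_lim_seq_div_affine (INR (S k) * PI) n)); intros H1.
  assert (H2 : is_lim_seq
    (fun q => 1 + (INR n - INR m) / INR (2 * q + m)) (1 + 0)).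
  { apply is_lim_seq_plus'; [apply is_lim_seq_const|apply is_lim_seq_div_affine]. }
  replace (/ INR (S k)) with (/ INR (S k) * ((1 + 0) * 1)) by ring.
  (* With x = p PI/(2q+n), [t] factors as 1/p times (2q+n)/(2q+m) times x f(x); the middle ratio is
     1 + (n-m)/(2q+m). *)
  apply is_lim_seq_ext_loc with
    (fun q => / INR (S k)
       * ((1 + (INR n - INR m) / INR (2 * q + m)) * (x q * f (x q)))).
  - exists 1%nat; intros q Hq; unfold t; fold (x q).
    assert (HN : 0 < INR (2 * q + n)) by (apply lt_0_INR; lia).
    assert (Hm : 0 < INR (2 * q + m)) by (apply lt_0_INR; lia).
    replace (1 + (INR n - INR m) / INR (2 * q + m))
      with (INR (2 * q + n) / INR (2 * q + m))
      by (revert Hm; rewrite !plus_INR; intros; field; lra).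
    unfold x at 1; specialize (Hpos k); field; repeat split; lra.
  - apply is_lim_seq_mult'; [apply is_lim_seq_const|].
    apply is_lim_seq_mult'; assumption. }
set (M := fun k => exp (Re s * ln (3 * INR (S n) * / INR (S k)))).
assert (HM : ex_series M).
{ apply ex_series_ext with
    (fun k => exp (Re s * ln (3 * INR (S n))) * exp (- Re s * ln (INR (S k)))).
  - intros k; unfold M; generalize (Hpos n), (Hpos k); intros Hn Hk.
    rewrite (ln_mult (3 * INR (S n))), ln_Rinv, <- exp_plus;
      [f_equal; ring|assumption|lra|now apply Rinv_0_lt_compat].
  - apply (ex_series_scal (K := R_AbsRing) (V := R_NormedModule)
             (exp (Re s * ln (3 * INR (S n))))
             (fun k => exp (- Re s * ln (INR (S k))))).
    apply ex_series_Rpower, hs. }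
assert (Hterm : forall k, zeta_term s k = Rcpow (/ INR (S k)) s)
  by (intros k; symmetry; apply Rcpow_inv, Hpos).
assert (HL : filterlim L eventually eventually).
{ apply (filterlim_eventually_of_le _ 2); intros q; unfold L.
  destruct (Nat.eq_dec q 0) as [->|Hq]; [lia|].
  assert (q - 1 <= (2 * q + n - 1) / 2)%nat
    by (apply Nat.div_le_lower_bound; lia).
  lia. }
assert (Hbound : forall q k, (2 <= q)%nat -> (k <= L q)%nat ->
  Rabs (Re (Rcpow (t q k) s)) <= M k /\ Rabs (Im (Rcpow (t q k) s)) <= M k).
{ intros q k Hq Hk; destruct (Ht q k Hq Hk).
  apply Rcpow_bound; lra. }
(* For q >= 2 the prefactor is absorbed into each summand, both bases being positive. *)
apply filterlim_ext_loc with (fun q => sum_n (fun k => Rcpow (t q k) s) (L q)).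
{ exists 2%nat; intros q Hq.
  assert (HLq : ((2 * q + n - 1) / 2 = S (L q))%nat).
  { assert (1 <= (2 * q + n - 1) / 2)%nat by (apply Nat.div_le_lower_bound; lia).
    unfold L; lia. }
  rewrite HLq, <- sum_n_m_S.
  etransitivity; [|apply (sum_n_m_mult_l (K := C_Ring))].
  apply sum_n_m_ext_loc; intros k [_ Hk]; symmetry.
  apply Rcpow_mult.
  - apply Rdiv_lt_0_compat; [apply PI_RGT_0|apply lt_0_INR; lia].
  - apply Hf, Hx; assumption. }
(* The coordinates of [zeta s] are by definition the real series that [tannery] yields as limits. *)
apply (filterlim_C eventually).
- apply filterlim_ext with (fun q => sum_n (fun k => Re (Rcpow (t q k) s)) (L q)).
  { intros q; now rewrite Re_Im_sum_n. }
  apply (tannery (fun q k => Re (Rcpow (t q k) s))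
           (fun k => Re (zeta_term s k)) M); [exact HL| |exact HM|].
  + intros k; rewrite Hterm.
    apply is_lim_seq_Rcpow; [now apply Rinv_0_lt_compat|apply Htlim].
  + exists 2%nat; intros q Hq k Hk; now apply Hbound.
- apply filterlim_ext with (fun q => sum_n (fun k => Im (Rcpow (t q k) s)) (L q)).
  { intros q; now rewrite Re_Im_sum_n. }
  apply (tannery (fun q k => Im (Rcpow (t q k) s))
           (fun k => Im (zeta_term s k)) M); [exact HL| |exact HM|].
  + intros k; rewrite Hterm.
    apply is_lim_seq_Rcpow; [now apply Rinv_0_lt_compat|apply Htlim].
  + exists 2%nat; intros q Hq k Hk; now apply Hbound.
Qed.

Theorem mainTheorem1 (s : C) (hs : 1 < Re s) (m n : nat) :
  filterlim
    (fun q : nat =>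
       (Rcpow (PI / INR (2 * q + m)) s *
        sum_n_m (fun p : nat => Rcpow (cot (INR p * PI / INR (2 * q + n))) s)
          1 ((2 * q + n - 1) / 2))%C)
    eventually (locally (zeta s))
  /\
  filterlim
    (fun q : nat =>
       (Rcpow (PI / INR (2 * q + m)) s *
        sum_n_m (fun p : nat => Rcpow (csc (INR p * PI / INR (2 * q + n))) s)
          1 ((2 * q + n - 1) / 2))%C)
    eventually (locally (zeta s)).
Proof.
split; apply zeta_limit; trivial.
- exact cot_bounds.
- exact is_lim_mult_cot.
- exact csc_bounds.
- exact is_lim_mult_csc.
Qed.
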